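(* Let $\mathcal{I}$ be a nontrivial admissible ideal of subsets of $\mathbb{N}$. The collection $\mathcal{T}^{\mathcal{I}}=\{A\in\mathcal{L}: A\subseteq\Theta_{\mathcal{I}}(A)\}$ is a topology on $\mathbb{R}$.
   Context: Let $\mathcal{L}$ be the $\sigma$-algebra of Lebesgue measurable subsets of $\mathbb{R}$ and $\lambda$ the Lebesgue measure. A family $\mathcal{I}\subseteq 2^{\mathbb{N}}$ is an ideal if it is closed under finite unions and under taking subsets; it is nontrivial if $\mathcal{I}\neq\{\emptyset\}$ and $\mathbb{N}\notin\mathcal{I}$; it is admissible if it contains all singletons. The associated filter is $\mathcal{F}(\mathcal{I})=\{M\subseteq\mathbb{N}:\mathbb{N}\setminus M\in\mathcal{I}\}$. For a real sequence $x=\{x_n\}_{n\in\mathbb{N}}$ put $A_x=\{a\in\mathbb{R}:\{k:x_k<a\}\notin\mathcal{I}\}$; then $\mathcal{I}\text{-}\liminf x=\inf A_x$ if $A_x\neq\emptyset$, and $\mathcal{I}\text{-}\liminf x=\infty$ if $A_x=\emptyset$. A sequence of closed intervals $\{J_n\}_{n\in\mathbb{N}}$ is about a point $p$ if $p\in\bigcap_n J_n$. Put $\mathscr{S}(J_n)=\{n\in\mathbb{N}:0<\lambda(J_n)<\frac1n\}$. For $E\in\mathcal{L}$ and $p\in\mathbb{R}$ the lower $\mathcal{I}$-density of $E$ at $p$ is $$\mathcal{I}\text{-}d_-(p,E)=\inf\left\{\mathcal{I}\text{-}\liminf \frac{\lambda(J_n\cap E)}{\lambda(J_n)}\right\},$$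 the infimum being over all sequences $\{J_n\}_{n\in\mathbb{N}}$ of closed intervals about $p$ with $\mathscr{S}(J_n)\in\mathcal{F}(\mathcal{I})$ (the values of the quotient for $n\notin\mathscr{S}(J_n)$, even if undefined, do not affect the $\mathcal{I}$-limit inferior and may be assigned arbitrarily). For $E\in\mathcal{L}$, $\Theta_{\mathcal{I}}(E)=\{x\in\mathbb{R}:\mathcal{I}\text{-}d_-(x,E)=1\}$. *)

(* Defs.v *)
From HB Require Import structures.
From mathcomp Require Import all_boot all_order all_algebra.
From mathcomp Require Import all_classical all_reals all_analysis.

Set Implicit Arguments.
Unset Strict Implicit.
Unset Printing Implicit Defensive.

Import Order.TTheory GRing.Theory Num.Theory.

Local Open Scope classical_set_scope.
Local Open Scope ring_scope.

(* The index n : nat stands for the positive integer n + 1: families of subsets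
   of {1, 2, ...} are represented as [set (set nat)] through this shift. *)

Definition is_ideal (I : set (set nat)) : Prop :=
  (forall A B, I A -> I B -> I (A `|` B)) /\
  (forall A B, B `<=` A -> I A -> I B).

Definition nontrivial_ideal (I : set (set nat)) : Prop :=
  I <> [set set0] /\ ~ I setT.

Definition admissible_ideal (I : set (set nat)) : Prop :=
  forall n, I [set n].

Definition ideal_filter (I : set (set nat)) : set (set nat) :=
  [set M | I (~` M)].

(* [ereal_inf set0 = +oo], as required when no real [a] qualifies. *)
Definition ideal_liminf (R : realType) (I : set (set nat)) (x : nat -> R) :
    \bar R :=
  ereal_inf [set a%:E | a in [set a : R | ~ I [set k | x k < a]]].

(* The domain of [completed_lebesgue_measure] is the Caratheodory sigma-algebra
   of the Lebesgue outer measure; the library's [measurable] on R is Borel. *)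
Definition lebesgue_measurable (R : realType) : set (set R) :=
  ((@wlength R idfun)^*)%mu.-cara.-measurable.

Definition lambda (R : realType) (A : set R) : \bar R :=
  completed_lebesgue_measure A.

Definition closed_intervals_about (R : realType) (p : R) (J : nat -> set R) :
    Prop :=
  forall n, (exists a b : R, J n = `[a, b]%classic) /\ J n p.

(* In view of the index shift, 1 / n reads 1 / (n + 1). *)
Definition short_indices (R : realType) (J : nat -> set R) : set nat :=
  [set n | (0 < lambda (J n) < (n.+1%:R^-1)%:E)%E].

(* Division by 0 gives 0, one of the arbitrary values allowed outside
   [short_indices J]. *)
Definition density_ratio (R : realType) (J : nat -> set R) (E : set R) (n : nat) :
    R :=
  fine (lambda (J n `&` E)) / fine (lambda (J n)).

Definition lower_ideal_density (R : realType) (I : set (set nat)) (p : R)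
    (E : set R) : \bar R :=
  ereal_inf [set ideal_liminf I (density_ratio J E) |
    J in [set J : nat -> set R | closed_intervals_about p J /\
                                 ideal_filter I (short_indices J)]].

Definition Theta (R : realType) (I : set (set nat)) (E : set R) : set R :=
  [set x | lower_ideal_density I x E = 1%E].

Definition ideal_density_topology (R : realType) (I : set (set nat)) :
    set (set R) :=
  [set A | lebesgue_measurable A /\ A `<=` Theta I A].

Definition is_topology (T : Type) (O : set (set T)) : Prop :=
  [/\ O set0, O setT,
      forall A B, O A -> O B -> O (A `&` B) &
      forall F : set (set T), F `<=` O -> O (\bigcup_(A in F) A)].

(* Main.v *)
Require Import Defs.
From mathcomp Require Import all_boot all_order all_algebra.
From mathcomp Require Import all_classical all_reals all_analysis.
From mathcomp Require Import measurable_realfun ring lra.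

(* Intersections: inside a short interval J, the relative measures satisfy
   r(A) + r(B) <= 1 + r(A & B), so r(A & B) < a < 1 forces r(A) or r(B) below
   (1 + a) / 2, which happens only along an index set of the ideal.

   Unions: the only difficulty is measurability.  Since Lebesgue measure is
   sigma-finite, a family F of measurable sets has a countable subfamily whose
   union B contains each member of F up to a null set.  The lower density ignores
   null sets, hence B is included in the union of F, itself included in Theta B,
   and Theta B \ B is null by the Lebesgue density theorem (an admissible
   nontrivial ideal contains no cofinite set, so ordinary limits dominate).
   Completeness of the measure concludes. *)

Set Implicit Arguments.
Unset Strict Implicit.
Unset Printing Implicit Defensive.

Import Order.TTheory GRing.Theory Num.Theory.
Import numFieldNormedType.Exports.

Local Open Scope classical_set_scope.
Local Open Scope ring_scope.

(** * Countable subfamilies with the same union up to null sets *)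

Section essential_union.
Context d (T : measurableType d) (R : realType).
Variable mu : {measure set T -> \bar R}.
Local Open Scope ereal_scope.

(** Merges a double sequence into a single one; an index that codes no pair falls back on a set
    already in the union. *)
Lemma bigcup_curry_pickle (G : nat -> nat -> set T) :
  \bigcup_k (if unpickle k is Some (n, m) then G n m else G 0%N 0%N) =
  \bigcup_n \bigcup_m G n m.
Proof.
apply/seteqP; split=> [x [k _]|x [n _ [m _ Gx]]].
- case: unpickle => [[n m]|] Gx; last by exists 0%N => //; exists 0%N.
  by exists n => //; exists m.
- by exists (pickle (n, m)) => //; rewrite pickleK.
Qed.

(* A sequence of members of F whose union has nearly maximal measure inside W
   exists at every precision; merging these sequences attains the supremum, so
   no member of F can add mass to the merged union. *)
Lemma essential_bigcup_on (W : set T) (F : set (set T)) :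
  measurable W -> mu W < +oo -> F !=set0 -> F `<=` measurable ->
  exists2 G : nat -> set T, forall n, F (G n) &
    forall A, F A -> mu (W `&` (A `\` \bigcup_n G n)) = 0.
Proof.
move=> mW Woo [A0 FA0] mF.
pose v (G : nat -> set T) := mu (W `&` \bigcup_n G n).
pose S := [set v G | G in [set G : nat -> set T | forall n, F (G n)]].
have mG (G : nat -> set T) : (forall n, F (G n)) -> measurable (\bigcup_n G n).
  by move=> FG; apply: bigcupT_measurable => n; exact: mF.
have vW G : (forall n, F (G n)) -> v G <= mu W.
  move=> FG; apply: le_measure; rewrite ?inE//.
  by apply: measurableI => //; exact: mG.
have vfin G : (forall n, F (G n)) -> v G \is a fin_num.
  by move=> FG; rewrite ge0_fin_numE// (le_lt_trans (vW _ FG)).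
have supfin : ereal_sup S \is a fin_num.
  rewrite ge0_fin_numE.
    by apply: le_lt_trans Woo; apply: ge_ereal_sup => _ [G FG <-]; exact: vW.
  apply: (@le_trans _ _ (v (fun=> A0))) => //.
  by apply: ereal_sup_ubound; exists (fun=> A0).
have inv0 n : (0 < n.+1%:R^-1 :> R)%R by rewrite invr_gt0.
have near_sup n : exists G : nat -> set T,
    (forall m, F (G m)) /\ ereal_sup S - n.+1%:R^-1%:E < v G.
  have [_ [G FG <-] ltG] := ub_ereal_sup_adherent (inv0 n) supfin.
  by exists G.
have [G /all_and2[FG vG]] := choice near_sup.
pose H k := if unpickle k is Some (n, m) then G n m else G 0%N 0%N.
have FH k : F (H k) by rewrite /H; case: unpickle => [[n m]|].
have supvH : ereal_sup S <= v H.
  apply/lee_addgt0Pr => _/posnumP[e]; near \oo => n.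
  rewrite -leeBlDr// (@le_trans _ _ (ereal_sup S - n.+1%:R^-1%:E))//.
    apply: leeB => //; rewrite lee_fin ltW//.
    by near: n; exact: near_infty_natSinv_lt.
  apply: (le_trans (ltW (vG n))); rewrite /v /H bigcup_curry_pickle.
  apply: le_measure; rewrite ?inE; try (apply: measurableI => //).
  - exact: mG.
  - by apply: bigcupT_measurable => k; exact: mG.
  - by apply: setIS; exact: (bigcup_sup (F := fun n => \bigcup_m G n m)).
exists H => // A FA.
(* Prepending [A] to [H] gives another competitor for the supremum, so [v K <= v H]; the finite
   [v H] then cancels. *)
pose K n := if n is m.+1 then H m else A.
have FK n : F (K n) by case: n.
have KE : \bigcup_n K n = \bigcup_n H n `|` (A `\` \bigcup_n H n).
  rewrite setDE setUIr setUCr setIT setUC.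
  apply/seteqP; split => [x [[|n] _ Kx]|x [Ax|[n _ Hx]]].
  - by left.
  - by right; exists n.
  - by exists 0%N.
  - by exists n.+1.
have mAH : measurable (A `\` \bigcup_n H n).
  by apply: measurableD; [exact: mF|exact: mG].
have vK : v K = v H + mu (W `&` (A `\` \bigcup_n H n)).
  rewrite /v KE setIUr measureU//; try (apply: measurableI => //).
    exact: mG.
  by apply/seteqP; split => // x [[_ Hx] [_ [_ nHx]]]; exact: nHx.
apply/eqP; rewrite -measure_le0 -(@leeD2lE _ (v H)) ?vfin// adde0 -vK.
by apply: le_trans supvH; apply: ereal_sup_ubound; exists K.
Unshelve. all: by end_near. Qed.

(** The sequences found on the countably many pieces [W n] of finite measure are merged; what
    remains of [A] is null on each piece, hence null by countable subadditivity. *)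
Lemma essential_bigcup (F : set (set T)) : sigma_finite setT mu ->
  F !=set0 -> F `<=` measurable ->
  exists2 G : nat -> set T, forall n, F (G n) &
    forall A, F A -> mu (A `\` \bigcup_n G n) = 0.
Proof.
move=> [W WT finW] F0 mF.
have onW n : exists G : nat -> set T, (forall m, F (G m)) /\
    forall A, F A -> mu (W n `&` (A `\` \bigcup_m G m)) = 0.
  have [mW Woo] := finW n.
  by have [G FG G0] := essential_bigcup_on mW Woo F0 mF; exists G.
have [G /all_and2[FG G0]] := choice onW.
pose H k := if unpickle k is Some (n, m) then G n m else G 0%N 0%N.
have FH k : F (H k) by rewrite /H; case: unpickle => [[n m]|].
have mH : measurable (\bigcup_k H k).
  by apply: bigcupT_measurable => k; exact: mF.
exists H => // A FA.
rewrite -(setTI (A `\` _)) WT setI_bigcupl.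
apply/eqP; rewrite -measure_le0.
have mWn n (B : set T) : measurable B -> measurable (W n `&` B).
  by move=> mB; apply: measurableI => //; exact: (finW n).1.
have mAH : measurable (A `\` \bigcup_k H k) by apply: measurableD => //; exact: mF.
apply: (le_trans (measure_sigma_subadditive mu _ _ (@subset_refl _ _))) => //.
- by move=> n; exact: mWn.
- by apply: bigcupT_measurable => n; exact: mWn.
rewrite eseries0// => n _ _; apply/eqP; rewrite -measure_le0 -(G0 n A FA).
apply: le_measure; rewrite ?inE; try exact: mWn.
  apply: mWn; apply: measurableD; first exact: mF.
  by apply: bigcupT_measurable => m; exact: mF.
apply: setIS; apply: setDS; rewrite /H bigcup_curry_pickle.
exact: (bigcup_sup (F := fun n => \bigcup_m G n m)).
Qed.

End essential_union.

(** * Lower ideal density: null sets and intersections *)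

Section lower_density.
Variable R : realType.
Implicit Types (A B E N : set R) (J : nat -> set R) (I : set (set nat)).

(** [lambda] is an outer measure on all sets, so this applies to sets not yet known to be
    measurable, such as [Theta I B]. *)
Lemma lambdaS A B : A `<=` B -> (lambda A <= lambda B)%E.
Proof. exact: (@le_outer_measure _ _ ((@wlength R idfun)^*)%mu). Qed.

Lemma lambda_ge0 A : (0 <= lambda A)%E.
Proof. exact: (outer_measure_ge0 ((@wlength R idfun)^*)%mu). Qed.

Lemma lambdaU_le A B : (lambda (A `|` B) <= lambda A + lambda B)%E.
Proof. exact: (outer_measureU2 ((@wlength R idfun)^*)%mu). Qed.

Lemma lambda_lebesgue A : lambda A = lebesgue_measure A.
Proof. by []. Qed.

Lemma lambda_itv (a b : R) : a <= b -> lambda `[a, b] = (b - a)%:E.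
Proof.
move=> ab; rewrite lambda_lebesgue lebesgue_measure_itv/= lte_fin.
by case: ltgtP ab => // -> _; rewrite subrr.
Qed.

Lemma lambda_about_fin (p : R) J n E :
  closed_intervals_about p J -> lambda (J n `&` E) \is a fin_num.
Proof.
move=> /(_ n)[[a [b ->]]] /=; rewrite in_itv/= => /andP[ap pb].
rewrite ge0_fin_numE ?lambda_ge0//.
apply: le_lt_trans (lambdaS (@subIsetl _ _ _)) _.
by rewrite lambda_itv ?ltry// (le_trans ap).
Qed.

Lemma density_ratio_le (p : R) J n A B : closed_intervals_about p J ->
  (lambda (J n `&` A) <= lambda (J n `&` B))%E ->
  density_ratio J A n <= density_ratio J B n.
Proof.
move=> Jp AB; rewrite /density_ratio ler_wpM2r ?invr_ge0 ?fine_ge0 ?lambda_ge0//.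
by rewrite fine_le ?(lambda_about_fin _ _ Jp).
Qed.

Lemma density_ratioT (p : R) J n : closed_intervals_about p J ->
  short_indices J n -> density_ratio J setT n = 1.
Proof.
move=> Jp /andP[J0 _]; rewrite /density_ratio setIT divff// gt_eqF// fine_gt0// J0.
by have := lambda_about_fin n setT Jp; rewrite setIT ge0_fin_numE ?lambda_ge0.
Qed.

Lemma density_ratio_le1 (p : R) J n E : closed_intervals_about p J ->
  density_ratio J E n <= 1.
Proof.
move=> Jp; apply: (@le_trans _ _ (density_ratio J setT n)).
  by apply: (density_ratio_le Jp); apply: lambdaS; exact: setIS.
rewrite /density_ratio setIT; have [->|J0] := eqVneq (fine (lambda (J n))) 0.
  by rewrite mul0r.
by rewrite divff.
Qed.

(** A test sequence shrinking to [p]: the factor 1/4 makes the length half of the allowed bound, so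
    that every index is short. *)
Definition centered (p : R) (n : nat) : set R :=
  `[p - 4^-1 * n.+1%:R^-1, p + 4^-1 * n.+1%:R^-1].

Lemma lambda_centered (p : R) n :
  lambda (centered p n) = (2^-1 * n.+1%:R^-1)%:E.
Proof.
have : 0 <= n.+1%:R^-1 :> R by [].
rewrite /centered; move: (n.+1%:R^-1 : R) => r r0.
by rewrite lambda_itv; [congr EFin; field|lra].
Qed.

Lemma centered_about (p : R) : closed_intervals_about p (centered p).
Proof.
move=> n; split; first by eexists; eexists.
have r0 : 0 <= 4^-1 * n.+1%:R^-1 :> R by rewrite mulr_ge0.
by rewrite /centered /= in_itv/= lerDl gerBl r0.
Qed.

Lemma centered_short (p : R) : short_indices (centered p) = setT.
Proof.
apply/seteqP; split => // n _.
rewrite /short_indices /= lambda_centered !lte_fin.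
have : 0 < n.+1%:R^-1 :> R by rewrite invr_gt0.
by move: (n.+1%:R^-1 : R) => r r0; apply/andP; split; lra.
Qed.

Lemma ideal_set0 I : is_ideal I -> admissible_ideal I -> I set0.
Proof. by move=> [_ IS] /(_ 0%N); apply: IS. Qed.

(** Admissibility puts every initial segment in [I]; together with a cofinite member it would cover
    all indices. *)
Lemma ideal_cofinite I M : is_ideal I -> nontrivial_ideal I ->
  admissible_ideal I -> (\forall n \near \oo, M n) -> ~ I M.
Proof.
move=> hI [_ IT] hadm [N _ NM] IM; apply: IT.
have [IU IS] := hI.
have Ilt : I [set k | (k < N)%N].
  elim: N {NM} => [|N IH]; first exact: IS (ideal_set0 hI hadm).
  apply: IS (IU _ _ IH (hadm N)) => k /=.
  by rewrite ltnS leq_eqVlt => /orP[/eqP->|]; [right|left].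
apply: IS (IU _ _ IM Ilt) => k _.
by have [kN|Nk] := ltnP k N; [right|left; exact: NM].
Qed.

Lemma lower_ideal_density_le1 I (p : R) E : is_ideal I -> nontrivial_ideal I ->
  admissible_ideal I -> (lower_ideal_density I p E <= 1)%E.
Proof.
move=> hI [_ IT] hadm.
have Jp := centered_about p.
apply: (@le_trans _ _ (ideal_liminf I (density_ratio (centered p) E))).
  apply: ereal_inf_lbound; exists (centered p) => //; split=> //.
  by rewrite /ideal_filter /= centered_short setCT; exact: ideal_set0.
(* All quotients lie below [1 + e], and the set of all indices is not in [I]. *)
apply/lee_addgt0Pr => e e0; apply: ereal_inf_lbound; exists (1 + e) => //=.
rewrite (_ : [set k | _] = setT)//; apply/seteqP; split=> // k _ /=.
by rewrite (le_lt_trans (density_ratio_le1 _ _ Jp))// ltrDl.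
Qed.

(** As the density never exceeds 1, being equal to 1 is only a lower bound on two nested infima,
    which unfolds to a condition free of infima. *)
Lemma ThetaP I E (p : R) :
  is_ideal I -> nontrivial_ideal I -> admissible_ideal I ->
  Theta I E p <-> forall J, closed_intervals_about p J ->
    ideal_filter I (short_indices J) ->
    forall a, a < 1 -> I [set k | density_ratio J E k < a].
Proof.
move=> hI hnt hadm; split=> [dE J Jp IJ a a1|IE].
  apply: contrapT => Ia; have : (1 <= a%:E)%E; last by rewrite lee_fin leNgt a1.
  rewrite -dE; apply: (@le_trans _ _ (ideal_liminf I (density_ratio J E))).
    by apply: ereal_inf_lbound; exists J.
  by apply: ereal_inf_lbound; exists a.
apply/eqP; rewrite eq_le lower_ideal_density_le1//=.
apply: le_ereal_inf_tmp => _ [J [Jp IJ] <-]; apply: le_ereal_inf_tmp => _ [a Ia <-].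
by rewrite lee_fin leNgt; apply/negP => /(IE J Jp IJ).
Qed.

(** Inside each interval, [A] is covered by [B] and the null set [A]\[B]. This yields both
    monotonicity and insensitivity to null sets. *)
Lemma subset_Theta I A B :
  is_ideal I -> nontrivial_ideal I -> admissible_ideal I ->
  lambda (A `\` B) = 0%E -> Theta I A `<=` Theta I B.
Proof.
move=> hI hnt hadm AB0 p /(ThetaP _ _ hI hnt hadm) IA.
apply/(ThetaP _ _ hI hnt hadm) => J Jp IJ a a1.
apply: hI.2 (IA J Jp IJ a a1) => k /=; apply: le_lt_trans.
apply: (density_ratio_le Jp); rewrite -[leRHS]adde0 -AB0.
apply: le_trans (lambdaU_le _ _); apply: lambdaS => x [Jx Ax].
by have [Bx|nBx] := pselect (B x); [left|right].
Qed.

Lemma ThetaT I : is_ideal I -> nontrivial_ideal I -> admissible_ideal I ->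
  Theta I [set: R] = setT.
Proof.
move=> hI hnt hadm; apply/seteqP; split=> // p _.
apply/(ThetaP _ _ hI hnt hadm) => J Jp IJ a a1.
(* A quotient below 1 can occur only off the short indices, where a degenerate interval gives 0. *)
apply: hI.2 IJ => k /= ka sk; move: ka; rewrite (density_ratioT Jp sk).
by rewrite ltNge (ltW a1).
Qed.

(** The Caratheodory criterion for [A] splits both [J n] and [J n]&[B]; the part of the latter
    outside [A] is at most that of the former. *)
Lemma density_ratioI (p : R) J n A B : closed_intervals_about p J ->
  short_indices J n -> lebesgue_measurable A ->
  density_ratio J A n + density_ratio J B n <= 1 + density_ratio J (A `&` B) n.
Proof.
move=> Jp sn mA; rewrite -(density_ratioT Jp sn) /density_ratio -!mulrDl.
rewrite ler_wpM2r ?invr_ge0 ?fine_ge0 ?lambda_ge0//.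
have fin E := lambda_about_fin n E Jp.
rewrite -!fineD ?fin// fine_le ?fin_numD ?fin//.
have JA : lambda (J n) = (lambda (J n `&` A) + lambda (J n `&` ~` A))%E by exact: mA.
have JB : lambda (J n `&` B) =
    (lambda (J n `&` (A `&` B)) + lambda (J n `&` (B `&` ~` A)))%E.
  by rewrite (setIC A) !setIA; exact: (mA (J n `&` B)).
rewrite setIT JA JB -addeA; apply: leeD2l.
rewrite [leLHS]addeC; apply: leeD => //.
by apply: lambdaS => x [Jx []].
Qed.

Lemma ThetaI I A B : is_ideal I -> nontrivial_ideal I -> admissible_ideal I ->
  lebesgue_measurable A -> Theta I A `&` Theta I B `<=` Theta I (A `&` B).
Proof.
move=> hI hnt hadm mA p [/(ThetaP _ _ hI hnt hadm) IA].
move=> /(ThetaP _ _ hI hnt hadm) IB.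
apply/(ThetaP _ _ hI hnt hadm) => J Jp IJ a a1.
have b1 : (1 + a) / 2 < 1 by lra.
have [IU IS] := hI.
apply: IS (IU _ _ IJ (IU _ _ (IA J Jp IJ _ b1) (IB J Jp IJ _ b1))) => k /= ka.
have [sk|] := pselect (short_indices J k); last by left.
right; have [|leA] := ltP (density_ratio J A k) ((1 + a) / 2); first by left.
right; apply: contraTT ka; rewrite -!leNgt => leB.
rewrite -(lerD2l 1) (le_trans _ (density_ratioI B Jp sk mA))//.
by rewrite [leLHS]splitr lerD.
Qed.

End lower_density.

(** * Lebesgue density and measurability of unions *)

Section density_topology.
Variable R : realType.

(** The Caratheodory sigma-algebra is the completion of the Borel one; the density theorem is then
    applied to the Borel part [X]. *)
Lemma lebesgue_measurable_decomp (B : set R) : lebesgue_measurable B ->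
  exists X N : set R, [/\ measurable X, lambda N = 0%E & B = X `|` N].
Proof.
move=> mB; have : (completed_algebra_gen (@lebesgue_measure R)).-sigma.-measurable B.
  by rewrite completed_caratheodory_measurable.
rewrite g_sigma_completed_algebra_genE => -[X mX [N N0 <-]].
by exists X, N; split=> //; exact/negligible_outer_measure.
Qed.

Lemma null_lebesgue_measurable (N : set R) :
  lambda N = 0%E -> lebesgue_measurable N.
Proof.
move=> /negligible_outer_measure[A [mA A0 NA]].
by apply: negligible_sub_caratheodory; exists A; split=> //; exact: sub_caratheodory.
Qed.

(* At a point x outside B the Lebesgue density of B is almost surely 0; then the
   quotients along the intervals [x - 1/(4n), x + 1/(4n)] tend to 0, while
   membership in Theta I B would make those below 1/2 rare. *)
Lemma Theta_setD_null (I : set (set nat)) (B : set R) :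
  is_ideal I -> nontrivial_ideal I -> admissible_ideal I ->
  lebesgue_measurable B -> lambda (Theta I B `\` B) = 0%E.
Proof.
move=> hI hnt hadm /lebesgue_measurable_decomp[X [N [mX N0 ->]]].
apply/negligible_outer_measure.
apply: negligibleS (lebesgue_density mX) => x [TB nB] dens.
have {TB} IB := (ThetaP _ _ hI hnt hadm).1 TB.
have Jx := centered_about x.
have IJ : ideal_filter I (short_indices (centered x)).
  by rewrite /ideal_filter /= centered_short setCT; exact: ideal_set0.
have half1 : 2^-1 < 1 :> R by rewrite invf_lt1// ltr1n.
apply: (ideal_cofinite hI hnt hadm) (IB _ Jx IJ _ half1).
pose f (r : R) : \bar R :=
  (lebesgue_measure (X `&` ball (x : R) r) * (lebesgue_measure (ball (x : R) r))^-1)%E.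
have {dens} : f r @[r --> 0^'+] --> 0%E.
  by move: dens; rewrite /= indicE memNset//; apply: contra_not nB => Xx; left.
have c0 : 0 < 4^-1 :> R by rewrite invr_gt0.
move=> /fine_cvgP[_ /cvgr_lt /(_ 4^-1 c0) f_lt].
have [e /= e0 He] : \forall r \near 0^'+, fine (f r) < 4^-1 by exact: f_lt.
have half0 : 0 < 2^-1 :> R by rewrite invr_gt0.
near=> n.
have n0 : 0 < n.+1%:R^-1 :> R by rewrite invr_gt0.
(* The number [s] is the length of [centered x n], so the open ball of radius [s] contains this
   closed interval. A density below 1/4 in that ball of length [2 * s] leaves [X] less than [s / 2],
   half of the interval. *)
pose s : R := 2^-1 * n.+1%:R^-1.
have s0 : 0 < s by rewrite mulr_gt0.
have se : s < e.
  rewrite (le_lt_trans (ler_piMl _ _)) ?invr_ge0 ?(ltW half1)//.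
  by near: n; have := near_infty_natSinv_lt (PosNum e0).
have fs : fine (f s) < 4^-1.
  by apply: (He s _ s0); rewrite /= sub0r normrN gtr0_norm.
have ball_s : lebesgue_measure (ball (x : R) s) = (s *+ 2)%:E.
  by rewrite lebesgue_measure_ball// ltW.
have fin_XB : lebesgue_measure (X `&` ball (x : R) s) \is a fin_num.
  rewrite ge0_fin_numE//; apply: le_lt_trans (lambdaS (@subIsetr _ _ _)) _.
  by rewrite lambda_lebesgue ball_s ltry.
have XB_lt : fine (lebesgue_measure (X `&` ball (x : R) s)) < 2^-1 * s.
  move: fs; rewrite /f ball_s inver mulrn_eq0/= gt_eqF//= fineM//=.
  rewrite ltr_pdivrMr ?mulrn_wgt0//; congr (_ < _).
  by field.
rewrite /= /density_ratio lambda_centered -/s /= ltr_pdivrMr//.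
apply: le_lt_trans XB_lt.
apply: fine_le => //; first exact: (lambda_about_fin _ _ Jx).
rewrite -lambda_lebesgue -[leRHS]adde0 -N0; apply: le_trans (lambdaU_le _ _).
apply: lambdaS => y [Jy [Xy|Ny]]; [left; split=> //|by right].
move: Jy; rewrite /centered /= in_itv/= => /andP[y1 y2].
rewrite /ball /= ltr_norml; move: y1 y2 n0; rewrite /s.
by move: (n.+1%:R^-1 : R) => r y1 y2 r0; apply/andP; split; lra.
Unshelve. all: by end_near. Qed.

Lemma ideal_density_topology_bigcup (I : set (set nat)) (F : set (set R)) :
  is_ideal I -> nontrivial_ideal I -> admissible_ideal I ->
  F `<=` ideal_density_topology I ->
  ideal_density_topology I (\bigcup_(A in F) A).
Proof.
move=> hI hnt hadm FO; have [->|/set0P F0] := eqVneq F set0.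
  by rewrite bigcup_set0; split=> //; exact: measurable0.
have mF : F `<=` @lebesgue_measurable R by move=> A /FO[].
have [G FG GF] := essential_bigcup
  (sigma_finiteT (@completed_lebesgue_measure R)) F0 mF.
pose B := \bigcup_n G n.
have BF : B `<=` \bigcup_(A in F) A by move=> x [n _ Gx]; exists (G n).
have mB : lebesgue_measurable B by apply: bigcupT_measurable => n; exact: mF.
have FB A : F A -> A `<=` Theta I B.
  move=> FA; apply: subset_trans (FO A FA).2 _; apply: subset_Theta => //.
  exact: GF.
split; last first.
  move=> x [A FA Ax]; have := (FO A FA).2 x Ax; apply: subset_Theta => //.
  rewrite (_ : A `\` _ = set0); first exact: measure0.
  by apply/seteqP; split=> // y [Ay []]; exists A.
(* The union is [B] plus a remainder inside [Theta I B]\[B], which is null. *)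
rewrite -(setDUK BF); apply: measurableU => //.
apply/null_lebesgue_measurable/eqP; rewrite eq_le lambda_ge0 andbT.
rewrite -(Theta_setD_null hI hnt hadm mB); apply: lambdaS => x [[A FA Ax] nBx].
by split=> //; exact: FB Ax.
Qed.

End density_topology.

Theorem theorem4p3 (R : realType) (I : set (set nat)) (hI : is_ideal I)
    (hnontriv : nontrivial_ideal I) (hadm : admissible_ideal I) :
  is_topology (@ideal_density_topology R I).
Proof.
split.
- by split=> //; exact: measurable0.
- by split; [exact: measurableT|rewrite ThetaT].
- move=> A B [mA TA] [mB TB]; split; first exact: measurableI.
  move=> x [Ax Bx]; apply: ThetaI => //; split; [exact: TA|exact: TB].
- by move=> F; exact: ideal_density_topology_bigcup.
Qed.
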